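(* There is an absolute constant $c>0$ such that the following holds. Let $\alpha(M)$, $M=1,2,\ldots$, be a sequence of positive real numbers such that $\alpha(M)\to 0$ as $M\to+\infty$ and $(\ln M)^{\alpha(M)}\geq 2$ for all $M\geq 3$. Then there is a constant $M_0>0$, depending only on the sequence $\alpha(M)$, such that for any positive integer $M\geq M_0$ there is a non-empty set $A\subset\{1,\ldots,M\}$ such that \[ \#\{n\in A:\ n\equiv 0\ (\mathrm{mod}\ p)\}=0 \] for any prime $p\leq(\ln M)^{\alpha(M)}$ and \[ \sum_{n\in A}\frac{n}{\varphi(n)}\geq\frac{c}{\alpha(M)}\,\#A. \]
   Context: $\varphi$ is Euler's totient function; $\ln$ is the natural logarithm; $\#S$ is the number of elements of a finite set $S$. *)

(* Defs.v *)
From mathcomp Require Import all_boot all_order all_algebra finmap.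
From mathcomp Require Import all_classical all_reals all_analysis.

Set Implicit Arguments.
Unset Strict Implicit.
Unset Printing Implicit Defensive.

(* Main.v *)
Require Import Defs.
From mathcomp Require Import all_boot all_order all_algebra finmap.
From mathcomp Require Import all_classical all_reals all_analysis.
From mathcomp Require Import ring lra zify.
Import Order.TTheory GRing.Theory Num.Theory numFieldNormedType.Exports.

Local Open Scope classical_set_scope.
Local Open Scope fset_scope.
Local Open Scope ring_scope.

(** The set {n} with n the product of the primes in (y, z] does the job, where
    y = (ln M)^alpha and z is the integer part of sqrt (ln M).  No prime up to
    y divides n, and n <= z! <= z^z <= exp (z^2) <= M.  Writing
    E(x) = \prod_(p <= x) (1 - 1/p)^-1, the ratio n / phi(n) is the product of
    (1 - 1/p)^-1 over y < p <= z, hence at least E(z) / E(y), and it suffices to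
    know the order of magnitude of E from both sides.

    Lower bound, [ln_le_euler_prod]: every m <= z has all its prime factors
    at most z, so E(z) >= \sum_(m <= z) 1/m >= ln (z + 1) >= (ln (ln M)) / 2.

    Upper bound, [euler_prod_le_ln]: E(y) = O(ln y).  This is the upper half of
    Mertens' third theorem, reached through Rankin's trick.  Up to the factor 2
    bounding \prod_k (1 - 1/k^2)^-1, E(y) is \prod_(p <= y) (1 + 1/p).  With
    s = 1 / ln y, replacing 1/p by p^-(1+s) costs at most the factor
    exp (s * \sum_(p <= y) (ln p)/p), which is bounded because
    \sum_(p <= y) (ln p)/p <= 2 ln y (read off from the prime factorization of
    a factorial).  After the replacement the product expands into distinct terms
    of the zeta series at 1 + s, whose sum is at most 1 + 1/s = 1 + ln y.

    As ln y = alpha ln (ln M), the quotient of the bounds is a constant times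
    1/alpha. *)

(** * Smooth numbers *)

Definition smooth (k m : nat) : bool :=
  (0 < m)%N && all (fun q => (q <= k)%N) (primes m).

Lemma smoothP {k m : nat} : smooth k m ->
  (0 < m)%N /\ forall q, prime q -> (q %| m)%N -> (q <= k)%N.
Proof.
case/andP=> m0 /allP h; split=> // q qp qm; apply: h.
by rewrite mem_primes qp m0.
Qed.

Lemma smooth0 (m : nat) : smooth 0 m = (m == 1%N).
Proof.
apply/idP/eqP => [/smoothP [m0 h]|-> //].
apply/eqP; rewrite eqn_leq m0 andbT leqNgt; apply/negP => m1.
by have := h _ (pdiv_prime m1) (pdiv_dvd m); rewrite leqNgt pdiv_gt0.
Qed.

(** Raising the smoothness bound to [k.+1] only admits new multiples of [k.+1],
    and only when [k.+1] is prime; both inductions on Euler products below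
    proceed by this step. *)
Lemma smoothS {k m : nat} : ~~ (prime k.+1 && (k.+1 %| m)%N) ->
  smooth k.+1 m = smooth k m.
Proof.
move=> nk; apply/idP/idP => /andP[m0 /allP h]; rewrite /smooth m0;
  apply/allP => q qm; have := h q qm; last exact: leqW.
rewrite leq_eqVlt => /predU1P[qk|//]; move: qm nk.
by rewrite qk mem_primes m0 => /andP[-> /= ->].
Qed.

Lemma smooth_mulS {k m : nat} : prime k.+1 ->
  smooth k.+1 (k.+1 * m) = smooth k.+1 m.
Proof.
move=> kp; rewrite /smooth muln_gt0 /=; case: (posnP m) => [-> //|m0].
apply/allP/allP => h q.
  by move=> qm; apply: h; rewrite primesM // qm orbT.
rewrite primesM // primes_prime // inE => /orP[/eqP->|/h //]; exact: leqnn.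
Qed.

(** * Products of primes and factorials *)

Lemma fact_le_expn (n : nat) : (n`! <= n ^ n)%N.
Proof.
elim: n => // n IH; rewrite factS expnS leq_mul2l /=.
by apply: leq_trans IH _; case: n => // n; rewrite leq_exp2r.
Qed.

Lemma prod_prime_le_fact (m n : nat) :
  (\prod_(m.+1 <= p < n.+1 | prime p) p <= n`!)%N.
Proof.
elim: n => [|n IH]; first by rewrite big_geq.
have [mn|nm] := leqP m n; last by rewrite big_geq // fact_gt0.
rewrite big_mkcond big_nat_recr //= -big_mkcond factS mulnC.
by apply: leq_mul => //; case: ifP.
Qed.

(** Among 1, ..., n there are [n %/ p] multiples of [p], so [p] occurs at
    least [n %/ p] times in the factorization of [n`!]. *)
Lemma prod_prime_pow_le_fact (n : nat) :
  (\prod_(1 <= p < n.+1 | prime p) p ^ (n %/ p) <= n`!)%N.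
Proof.
have nf : (n.+1 <= n`!.+1)%N by rewrite ltnS; elim: n => // -[|n] IH //;
  rewrite factS -[leqLHS]muln1 leq_mul // fact_gt0.
rewrite -[leqRHS](partnT (fact_gt0 n)) (widen_partn _ (leqnn _)).
rewrite [leqRHS]big_ltn //=.
rewrite lognE /= expn0 mul1n [leqRHS](big_cat_nat (ltn0Sn n) nf) /=.
rewrite -[leqLHS]muln1; apply: leq_mul; last first.
  by rewrite big_nat_cond; apply: prodn_cond_gt0 => -[].
rewrite big_mkcond !big_nat; apply: leq_prod => p /andP[p0 pn].
case: ifP => pp; last by rewrite expn_gt0 p0.
by rewrite leq_exp2l ?prime_gt1 // logn_fact //
  (big_ltn (leq_ltn_trans p0 pn)) expn1 leq_addr.
Qed.

(** * Lower bound for the Euler product *)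

Section EulerProducts.
Variable R : realType.

Lemma ler_sum_uniq_sub (T : eqType) (s t : seq T) (f : T -> R) :
  uniq s -> uniq t -> {subset s <= t} -> (forall i, 0 <= f i) ->
  \sum_(i <- s) f i <= \sum_(i <- t) f i.
Proof.
move=> us ut st f0.
rewrite (perm_big [seq i <- t | i \in s]) /=; last first.
  apply: uniq_perm => //; first exact: filter_uniq.
  move=> i; rewrite mem_filter; apply/idP/andP => [si|[] //].
  by split=> //; exact: st.
rewrite big_filter big_mkcond /=; apply: ler_sum => i _.
by case: ifP.
Qed.

Lemma big_prime_recr (F : nat -> R) (n : nat) :
  \prod_(1 <= p < n.+2 | prime p) F p =
  \prod_(1 <= p < n.+1 | prime p) F p * (if prime n.+1 then F n.+1 else 1).
Proof. by rewrite big_mkcond big_nat_recr //= -big_mkcond. Qed.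

Definition euler_prod (n : nat) : R :=
  \prod_(1 <= p < n.+1 | prime p) (1 - p%:R^-1)^-1.

Lemma prime_factor_ge1 {p : nat} : prime p -> 1 <= (1 - p%:R^-1 : R)^-1.
Proof.
move=> /prime_gt1 p1; have p1' : 1 < p%:R :> R by rewrite ltr1n.
have : 0 < (p%:R^-1 : R) by rewrite invr_gt0; lra.
have : (p%:R^-1 : R) < 1 by rewrite invf_lt1; lra.
move=> h1 h2; rewrite invf_ge1; lra.
Qed.

Lemma prime_factors_ge1 (m n : nat) :
  1 <= \prod_(m <= p < n | prime p) (1 - p%:R^-1 : R)^-1.
Proof.
elim/big_ind: _ => // [x y|p]; [exact: mulr_ege1|exact: prime_factor_ge1].
Qed.

(** Truncating the sum at [N] makes the induction elementary.  If T is the sum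
    for [k.+1] prime, its terms not divisible by [k.+1] sum to at most the
    product for [k], and dividing the other indices by [k.+1] yields indices of
    T again, so that T <= euler_prod k + T / k.+1, which is solved for T. *)
Lemma smooth_sum_le_euler_prod (k N : nat) :
  \sum_(m <- [seq m <- index_iota 1 N.+1 | smooth k m]) m%:R^-1
    <= euler_prod k.
Proof.
elim: k => [|k IH].
  rewrite /euler_prod big_geq // big_filter.
  under eq_bigl do rewrite smooth0.
  rewrite -big_filter; apply: (le_trans (y := \sum_(m <- [:: 1%N]) m%:R^-1)).
    apply: ler_sum_uniq_sub => //; first by rewrite filter_uniq ?iota_uniq.
    by move=> m; rewrite mem_filter inE => /andP[].
  by rewrite big_seq1 invr1.
case: (boolP (prime k.+1)) => kp; last first.
  rewrite /euler_prod big_prime_recr (negbTE kp) mulr1; apply: le_trans IH.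
  rewrite le_eqVlt; apply/orP; left; apply/eqP; congr (bigop.body _ _ _).
  by apply: eq_filter => m; rewrite smoothS // negb_and kp.
rewrite /euler_prod big_prime_recr kp -/(euler_prod k).
have := prime_factor_ge1 kp; set a := k.+1%:R^-1 => ha.
set T := (X in X <= _).
suff : T <= euler_prod k + a * T.
  have a1 : 0 < 1 - a by rewrite -invr_gt0 (lt_le_trans ltr01).
  by rewrite ler_pdivlMr // mulrBr mulr1 (mulrC T) lerBlDr.
rewrite {1}/T (bigID (fun m => k.+1 %| m)%N) /= addrC; apply: lerD.
  apply: le_trans IH; rewrite -big_filter -filter_predI.
  apply: ler_sum_uniq_sub => //; rewrite ?filter_uniq ?iota_uniq //.
  move=> m; rewrite !mem_filter => /andP[/andP[/= km sm] ->].
  by rewrite andbT -smoothS // negb_and km orbT.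
rewrite /T big_distrr /= -big_filter -filter_predI.
under [X in _ <= X]eq_bigr do rewrite /a -invfM -natrM.
rewrite -(big_map (fun m => k.+1 * m)%N predT (fun m => m%:R^-1)).
apply: ler_sum_uniq_sub => //.
- by rewrite filter_uniq ?iota_uniq.
- by rewrite map_inj_uniq ?filter_uniq ?iota_uniq // => x y /eqP;
    rewrite eqn_pmul2l // => /eqP.
move=> m; rewrite mem_filter => /andP[/andP[/= /dvdnP[j ->]]].
rewrite mulnC smooth_mulS // => sj; rewrite mem_index_iota => hj.
apply: map_f; rewrite mem_filter sj mem_index_iota; nia.
Qed.

(** The increments compare: ln (1 + 1/m) <= 1/m. *)
Lemma ln_le_harmonic (n : nat) :
  ln n.+1%:R <= \sum_(1 <= m < n.+1) (m%:R^-1 : R).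
Proof.
elim: n => [|n IH]; first by rewrite big_geq // ln1.
rewrite big_nat_recr //=.
have n0 : (n.+1%:R : R) != 0 by rewrite pnatr_eq0.
have -> : (n.+2%:R : R) = n.+1%:R * (1 + n.+1%:R^-1).
  by rewrite mulrDr mulr1 mulfV // natr1.
rewrite lnM ?posrE ?ltr0n ?addr_gt0 ?invr_gt0 ?ltr0n //.
apply: lerD => //; apply: le_ln1Dx.
by apply: (@lt_trans _ _ 0); rewrite ?ltrN10 // invr_gt0 ltr0n.
Qed.

Lemma ln_le_euler_prod (n : nat) : ln n.+1%:R <= euler_prod n.
Proof.
apply: le_trans (smooth_sum_le_euler_prod n n).
apply: le_trans (ln_le_harmonic n) _.
have -> // : [seq m <- index_iota 1 n.+1 | smooth n m] = index_iota 1 n.+1.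
apply/all_filterP/allP => m; rewrite mem_index_iota => /andP[m0 mn].
rewrite /smooth m0; apply/allP => q; rewrite mem_primes => /and3P[_ _ qm].
exact: leq_trans (dvdn_leq m0 qm) mn.
Qed.

(** * Upper bound for the Euler product *)

(** Expanding the product lists each squarefree product of primes up to [k] once.
    The multiplicity-free list is what allows a comparison with a partial sum of
    the series of [f]; smoothness is the invariant that keeps the old terms apart
    from their multiples by the next prime. *)
Lemma prod_prime_eq_smooth_sum (f : nat -> R) (k : nat) :
  f 1%N = 1 -> {morph f : m n / (m * n)%N >-> m * n} ->
  exists s : seq nat, [/\ uniq s, all (smooth k) s &
    \prod_(1 <= p < k.+1 | prime p) (1 + f p) = \sum_(m <- s) f m].
Proof.
move=> f1 fM; elim: k => [|k [s [us ss IH]]].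
  by exists [:: 1%N]; rewrite big_geq // big_seq1 f1.
rewrite big_prime_recr IH.
case: ifP => kp; last first.
  exists s; split; rewrite ?mulr1 //.
  by apply: sub_all ss => m; rewrite smoothS ?kp.
exists (s ++ [seq k.+1 * m | m <- s]%N).
have ndvd m : smooth k m -> ~~ (k.+1 %| m)%N.
  by case/smoothP => m0 h; apply/negP => /(h _ kp); rewrite ltnn.
split.
- rewrite cat_uniq us map_inj_uniq ?us ?andbT /=; last by move=> x y /eqP;
    rewrite eqn_pmul2l // => /eqP.
  apply/hasPn => _ /mapP[m _ ->]; apply/negP => /(allP ss)/ndvd.
  by rewrite dvdn_mulr.
- rewrite all_cat; apply/andP; split.
    by apply: sub_all ss => m sm; rewrite smoothS // negb_and (ndvd _ sm) orbT.
  apply/allP => _ /mapP[m /(allP ss) sm ->].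
  by rewrite smooth_mulS // smoothS // negb_and (ndvd _ sm) orbT.
rewrite big_cat big_map /= mulrDr mulr1 mulrC; congr (_ + _).
by rewrite big_distrr /=; apply: eq_bigr => m _; rewrite fM.
Qed.

(** Telescoping form of the integral comparison: the term of index n + 2 is at
    most ((n+1)^-s - (n+2)^-s) / s. *)
Lemma zeta_partial_le (s : R) (N : nat) : 0 < s ->
  \sum_(1 <= m < N.+1) m%:R `^ (- (1 + s)) <= 1 + s^-1.
Proof.
move=> s0.
suff h n : \sum_(1 <= m < n.+2) m%:R `^ (- (1 + s))
    <= 1 + (1 - n.+1%:R `^ (- s)) / s.
  case: N => [|n]; first by rewrite big_geq // addr_ge0 // invr_ge0 ltW.
  apply: le_trans (h n) _; rewrite lerD2l -[X in _ <= X]mul1r.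
  by rewrite ler_pM2r ?invr_gt0 // gerBl powR_ge0.
elim: n => [|n IH]; first by rewrite big_nat1 !powR1 subrr mul0r addr0.
rewrite big_nat_recr //=; apply: le_trans (lerD IH (lexx _)) _.
have n0 : 0 < (n.+1%:R : R) by rewrite ltr0n.
have n2 : 0 < (n.+2%:R : R) by rewrite ltr0n.
have -> : (n.+2%:R `^ (- (1 + s)) : R) = n.+2%:R^-1 * n.+2%:R `^ (- s).
  by rewrite opprD powRD ?(gt_eqF n2) ?implybT // powR_inv1 // ltW.
have key : n.+2%:R `^ (- s) * (1 + s / n.+2%:R) <= n.+1%:R `^ (- s) :> R.
  rewrite /powR !gt_eqF //.
  apply: (le_trans (y := expR (- s * ln n.+2%:R) * expR (s / n.+2%:R))).
    by rewrite ler_pM2l ?expR_gt0 // expR_ge1Dx.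
  rewrite -expRD ler_expR.
  have h : ln n.+1%:R <= ln n.+2%:R - n.+2%:R^-1 :> R.
    have -> : (n.+1%:R : R) = n.+2%:R * (1 - n.+2%:R^-1).
      by rewrite mulrBr mulr1 mulfV ?gt_eqF // -(natr1 n.+1) addrK.
    have i1 : (n.+2%:R^-1 : R) < 1 by rewrite invf_lt1 // ltr1n.
    rewrite lnM ?posrE ?subr_gt0 // lerD2l; apply: le_ln1Dx.
    by rewrite ltrN2.
  move: (ln _) (ln _) (_^-1) h => u v w /(ler_wpM2l (ltW s0)); lra.
set x := n.+1%:R `^ _ in key *; set y := n.+2%:R `^ _ in key *.
rewrite -addrA lerD2l -(ler_pM2r s0) mulrDl !divfK ?gt_eqF //.
move: (n.+2%:R^-1) key => w; lra.
Qed.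

Lemma ln_prod_nat (r : seq nat) (P : pred nat) (F : nat -> nat) :
  (forall i, P i -> (0 < F i)%N) ->
  ln (\prod_(i <- r | P i) F i)%:R = \sum_(i <- r | P i) ln ((F i)%:R : R).
Proof.
move=> F0; suff [] : (0 < \prod_(i <- r | P i) F i)%N /\
    ln (\prod_(i <- r | P i) F i)%:R = \sum_(i <- r | P i) ln ((F i)%:R : R) by [].
apply: (big_rec2 (fun (x : nat) (y : R) => (0 < x)%N /\ ln x%:R = y)).
  by rewrite ln1.
move=> i x y Pi [x0 <-]; have Fi0 := F0 i Pi; split; first by rewrite muln_gt0 Fi0.
by rewrite natrM lnM // posrE ltr0n.
Qed.

(** A crude form of Mertens' first theorem: compare logarithms in
    \prod_p p ^ (n %/ p) <= n! <= n^n, where [n %/ p] is at least n / (2p). *)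
Lemma sum_ln_prime_le (n : nat) : (0 < n)%N ->
  \sum_(1 <= p < n.+1 | prime p) ln (p%:R : R) / p%:R <= 2 * ln n%:R.
Proof.
move=> n0; have n0' : 0 < (n%:R : R) by rewrite ltr0n.
have lnn : \sum_(1 <= p < n.+1 | prime p) ln (p%:R : R) *+ (n %/ p)
    <= n%:R * ln n%:R.
  apply: (le_trans (y := ln n`!%:R)); last first.
    rewrite mulr_natl -lnXn // ler_ln ?posrE ?exprn_gt0 ?ltr0n ?fact_gt0 //.
    by rewrite -natrX ler_nat fact_le_expn.
  under eq_bigr => p pp do rewrite -lnXn ?ltr0n ?prime_gt0 // -natrX.
  rewrite -ln_prod_nat; last by move=> p pp; rewrite expn_gt0 prime_gt0.
  rewrite ler_ln ?posrE ?ltr0n ?fact_gt0 ?ler_nat ?prod_prime_pow_le_fact //.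
  by apply: prodn_cond_gt0 => p pp; rewrite expn_gt0 prime_gt0.
rewrite -(ler_pM2l n0') mulrCA; apply: le_trans (ler_wpM2l (ler0n _ 2) lnn).
rewrite !big_distrr /= big_nat_cond [leRHS]big_nat_cond.
apply: ler_sum => p /andP[/andP[_ pn] /prime_gt1 p1].
have p0 : 0 < (p%:R : R) by rewrite ltr0n ltnW.
rewrite -[ln _ *+ _]mulr_natr mulrCA [leRHS]mulrCA.
rewrite ler_wpM2l ?ln_ge0 ?ler1n 1?ltnW // ler_pdivrMr // -!natrM ler_nat.
rewrite {1}(divn_eq n p) -mulnA mul2n -addnn leq_add2l.
apply: leq_trans (ltnW (ltn_pmod n (ltnW p1))) _.
by rewrite leq_pmull // divn_gt0 // ltnW.
Qed.

(** The quotient of the two products is \prod_p (1 - 1/p^2)^-1.  Extending it from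
    primes to all 2 <= k <= m + 1 gives a telescoping product with value
    2 - 2 / (m + 2), the factor carried by the induction. *)
Lemma euler_prod_le_squarefree (n : nat) :
  euler_prod n <= 2 * \prod_(1 <= p < n.+1 | prime p) (1 + p%:R^-1).
Proof.
have pos m : 0 <= \prod_(1 <= p < m | prime p) (1 + p%:R^-1 : R).
  by apply: prodr_ge0 => p _; rewrite addr_ge0 // invr_ge0.
suff h m : euler_prod m.+1 <=
    (2 - 2 / m.+2%:R) * \prod_(1 <= p < m.+2 | prime p) (1 + p%:R^-1).
  case: n => [|n]; first by rewrite /euler_prod !big_geq // mulr1 ler1n.
  apply: le_trans (h n) _; apply: ler_wpM2r => //.
  by rewrite gerBl divr_ge0.
elim: m => [|m IH].
  rewrite /euler_prod !big_prime_recr /= !big_geq //; lra.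
rewrite /euler_prod !(big_prime_recr _ m.+1) -/(euler_prod m.+1).
set Q := \prod_(_ <= _ < _ | _) _ in IH *.
have m2 : 2 <= (m.+2%:R : R) by rewrite ler_nat.
rewrite -(natr1 m.+2).
set x := m.+2%:R in IH m2 *.
have x0 : 0 < x by lra.
have Q0 : 0 <= Q by exact: pos.
have a1 : 2 - 2 / x = 2 * (x - 1) / x by field; lra.
have a2 : 2 - 2 / (x + 1) = 2 * x / (x + 1) by field; lra.
have le12 : 2 - 2 / x <= 2 - 2 / (x + 1).
  by rewrite lerD2l lerN2 ler_pM2l // lef_pV2 ?posrE; lra.
case: ifP => [mp|_]; last first.
  by rewrite !mulr1; apply: le_trans IH _; exact: ler_wpM2r.
have i0 : 0 <= (1 - x^-1)^-1.
  have : x^-1 < 1 by rewrite invf_lt1; lra.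
  by rewrite invr_ge0 subr_ge0 => /ltW.
apply: le_trans (ler_wpM2r i0 IH) _.
rewrite a1 a2 le_eqVlt; apply/orP; left; apply/eqP; clearbody x; field.
by apply/and3P; split; lra.
Qed.

(** Rankin's trick: pass from 1/p to f p = p^-(1+s) with s = 1 / ln n. *)
Lemma squarefree_euler_prod_le (n : nat) : (1 < n)%N ->
  \prod_(1 <= p < n.+1 | prime p) (1 + p%:R^-1 : R) <=
  (1 + ln n%:R) * expR 2.
Proof.
move=> n1; have L0 : 0 < ln (n%:R : R) by rewrite ln_gt0 // ltr1n.
set s := (ln (n%:R : R))^-1; have s0 : 0 < s by rewrite invr_gt0.
pose f (m : nat) : R := m%:R `^ (- (1 + s)).
have f0 m : 0 <= f m by exact: powR_ge0.
apply: (le_trans (y := \prod_(1 <= p < n.+1 | prime p)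
    ((1 + f p) * expR (s * (ln p%:R / p%:R))))).
  (* 1/p - f p <= s (ln p)/p because 1 - e^-x <= x at x = s ln p; moreover
     1 + a + b <= (1 + a) e^b for a, b >= 0. *)
  apply: ler_prod => p /prime_gt0 p0; rewrite addr_ge0 ?invr_ge0 //=.
  have p0' : 0 < (p%:R : R) by rewrite ltr0n.
  have fE : f p = p%:R^-1 * expR (- s * ln p%:R).
    rewrite /f opprD powRD ?(gt_eqF p0') ?implybT // powR_inv1 ?ltW //.
    by rewrite /powR gt_eqF.
  have := expR_ge1Dx (s * (ln p%:R / p%:R)).
  have e1 := expR_ge1Dx (- s * ln p%:R).
  have i0 : 0 <= p%:R^-1 :> R by rewrite invr_ge0.
  have := ler_wpM2l i0 e1; rewrite -fE => h1 h2.
  have h3 : 0 <= s * (ln p%:R / p%:R).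
    apply: mulr_ge0; first exact: ltW.
    by rewrite divr_ge0 // ln_ge0 // ler1n.
  have := ler_wpM2l (addr_ge0 ler01 (f0 p)) h2.
  have := mulr_ge0 (f0 p) h3; lra.
rewrite big_split /= -expR_sum -big_distrr /=.
apply: ler_pM; [|exact: expR_ge0| |].
- by apply: prodr_ge0 => p _; rewrite addr_ge0.
- have [||t [ut st ->]] := @prod_prime_eq_smooth_sum f n.
  + by rewrite /f powR1.
  + by move=> a b; rewrite /f natrM powRM.
  have := @zeta_partial_le s (\max_(m <- t) m)%N s0.
  rewrite {2}/s invrK; apply: le_trans.
  apply: ler_sum_uniq_sub => //; first exact: iota_uniq.
  move=> m mt; rewrite mem_index_iota ltnS (leq_bigmax_seq _ mt) // andbT.
  by case/andP: (allP st _ mt).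
rewrite ler_expR /s mulrC ler_pdivrMr //; exact: sum_ln_prime_le (ltnW n1).
Qed.

(** The additive 1 in 1 + ln n is absorbed using ln n >= ln 2 >= 1/2. *)
Lemma euler_prod_le_ln (n : nat) : (1 < n)%N ->
  euler_prod n <= 6 * expR 2 * ln n%:R.
Proof.
move=> n1; apply: le_trans (euler_prod_le_squarefree n) _.
have := squarefree_euler_prod_le n n1.
have l2 : ln 2 <= ln (n%:R : R).
  by rewrite ler_ln ?posrE // ?ler_nat // ltr0n ltnW.
have : 1 / 2 <= ln (2 : R).
  have h : -1 < - (1 / 2) :> R by lra.
  have := le_ln1Dx h; have -> : 1 + - (1 / 2) = 2^-1 :> R by lra.
  rewrite lnV ?posrE //; lra.
move=> h; have := ler_wpM2r (expR_ge0 2) (le_trans h l2); lra.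
Qed.

(** * The ratio of n to its totient *)

Lemma ratio_totient_prod_primes (r : seq nat) : uniq r -> all prime r ->
  let N := (\prod_(p <- r) p)%N in
  N%:R / (totient N)%:R = \prod_(p <- r) (1 - p%:R^-1 : R)^-1.
Proof.
elim: r => [|p r IH] /=; first by rewrite !big_nil divr1.
move=> /andP[pr ur] /andP[pp rp]; rewrite !big_cons -IH //.
rewrite totient_coprime; last first.
  rewrite prime_coprime // Euclid_dvd_prod // big_has; apply/hasPn => q qr.
  have qp : prime q by exact: (allP rp).
  by apply/negP; rewrite /= dvdn_prime2 // => /eqP pq; rewrite pq qr in pr.
rewrite totient_prime // !natrM invfM mulrACA; congr (_ * _).
have p0 : (p%:R : R) != 0 by rewrite pnatr_eq0 -lt0n prime_gt0.
have -> : p.-1%:R = p%:R - 1 :> R by rewrite -subn1 natrB // prime_gt0.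
have p1 : (p%:R - 1 : R) != 0 by rewrite subr_eq0 pnatr_eq1;
  case: p pp {pr p0} => [|[|]].
by field; rewrite p0.
Qed.

(** An equality when [y <= z]; otherwise the tail is empty and the bound expresses
    that the Euler product is monotone. *)
Lemma euler_prod_le_mul_tail (y z : nat) :
  euler_prod z <=
  euler_prod y * \prod_(y.+1 <= p < z.+1 | prime p) (1 - p%:R^-1)^-1.
Proof.
have [yz|zy] := leqP y z.
  by rewrite /euler_prod (@big_cat_nat _ _ _ y.+1).
have e0 := prime_factors_ge1; rewrite (@big_geq _ _ _ y.+1) 1?ltnW // mulr1.
rewrite {2}/euler_prod (@big_cat_nat _ _ _ z.+1) //= ?ltnS 1?ltnW //.
by apply: ler_peMr; [apply: le_trans (e0 _ _)|apply: e0].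
Qed.

End EulerProducts.

(** * The theorem *)

Theorem theorem1p2 (R : realType) :
  exists2 c : R, 0 < c &
  forall alpha : nat -> R,
    (forall M : nat, (1 <= M)%N -> 0 < alpha M) ->
    alpha M @[M --> \oo] --> (0 : R) ->
    (forall M : nat, (3 <= M)%N -> 2 <= ln (M%:R : R) `^ alpha M) ->
    exists2 M0 : R, 0 < M0 &
    forall M : nat, (0 < M)%N -> M0 <= M%:R ->
      exists A : {fset nat},
        [/\ A != fset0,
            (forall n : nat, n \in A -> (1 <= n <= M)%N),
            (forall p : nat, prime p -> p%:R <= ln (M%:R : R) `^ alpha M ->
               #|` [fset n in A | n == 0 %[mod p]]| = 0%N)
          & c / alpha M * #|` A|%:R
              <= \sum_(n <- A) n%:R / (totient n)%:R].
Proof.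
have e0 : 0 < expR (2 : R) by exact: expR_gt0.
(* 12 = 6 * 2: the constant of [euler_prod_le_ln] and the 2 lost in
   ln (ln M) <= 2 ln (z + 1). *)
exists (12 * expR 2)^-1; first by rewrite invr_gt0 mulr_gt0.
move=> alpha alpha0 _ alpha2.
(* From exp 2 on, ln M >= 2, so that ln (ln M) is positive. *)
exists (expR 2) => // M M0 Me.
have M3 : (3 <= M)%N by rewrite -(ler_nat R); have := expR_ge1Dx (2 : R); lra.
have MR : 0 < (M%:R : R) by rewrite ltr0n.
have a0 := alpha0 M M0; have {}alpha2 := alpha2 M M3.
set L := ln _ in alpha2 *; set y := L `^ _ in alpha2 *.
have L1 : 2 <= L by rewrite -(expRK 2) ler_ln ?posrE.
have L0 : 0 <= L by lra.
pose Y := Num.truncn y; pose Z := Num.truncn (Num.sqrt L).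
have Y2 : (1 < Y)%N by rewrite truncn_ge_nat // powR_ge0.
pose N := (\prod_(Y.+1 <= p < Z.+1 | prime p) p)%N.
have N0 : (0 < N)%N by apply: prodn_cond_gt0 => p; exact: prime_gt0.
exists [fset N]%fset; split.
- by apply/fset0Pn; exists N; rewrite inE.
- move=> n; rewrite inE => /eqP ->; rewrite N0 /= -(ler_nat R).
  have NZ : (N <= Z ^ Z)%N.
    exact: leq_trans (prod_prime_le_fact Y Z) (fact_le_expn Z).
  have NZ' : (N%:R : R) <= Z%:R ^+ Z by rewrite -natrX ler_nat.
  apply: le_trans NZ' _.
  have Z0 : 0 <= (Z%:R : R) by [].
  apply: (le_trans (y := expR (Z%:R) ^+ Z)).
    by apply: lerXn2r; rewrite ?nnegrE ?expR_ge0 //;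
      have := expR_ge1Dx (Z%:R : R); lra.
  rewrite -expRM_natl -[leRHS]lnK ?posrE // -/L ler_expR -expr2 -(sqr_sqrtr L0).
  by apply: lerXn2r; rewrite ?nnegrE ?sqrtr_ge0 // truncn_le sqrtr_ge0.
- move=> p pp py; apply/eqP; rewrite cardfs_eq0; apply/eqP/fsetP => n.
  rewrite !inE; apply/negP => /andP[/eqP -> ]; rewrite mod0n -/(dvdn p N).
  rewrite Euclid_dvd_prod // big_has_cond => /hasP[q].
  rewrite mem_index_iota => /andP[Yq _] /andP[qp]; rewrite dvdn_prime2 // => /eqP pq.
  have : (p <= Y)%N by rewrite truncn_ge_nat // powR_ge0.
  by rewrite pq leqNgt Yq.
rewrite cardfs1 mulr1 big_seq_fset1.
rewrite /N -big_filter ratio_totient_prod_primes ?filter_uniq ?iota_uniq ?filter_all //.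
rewrite big_filter.
have h1 := le_trans (ln_le_euler_prod R Z) (euler_prod_le_mul_tail R Y Z).
have h2 := euler_prod_le_ln R Y Y2.
set P := \prod_(_ <= _ < _ | _) _ in h1 *.
have P1 : 1 <= P by exact: prime_factors_ge1.
have h3 : ln Y%:R <= alpha M * ln L.
  rewrite -ln_powR ler_ln ?posrE ?ltr0n ?powR_gt0 1?ltnW //; last lra.
  by rewrite truncn_le powR_ge0.
have h4 : ln L <= 2 * ln Z.+1%:R.
  have sL : 0 < Num.sqrt L by rewrite sqrtr_gt0; lra.
  have -> : ln L = 2 * ln (Num.sqrt L).
    by rewrite -{1}(sqr_sqrtr L0) lnXn // mulr_natl.
  rewrite ler_wpM2l // ler_ln ?posrE // ltW //.
  by case/andP: (truncn_itv (ltW sL)).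
have lL : 0 < ln L by rewrite ln_gt0; lra.
have E : ln L <= 12 * expR 2 * alpha M * P * ln L.
  have P0 : 0 <= P by lra.
  have e6 : 0 <= 6 * expR (2 : R) by lra.
  have := ler_wpM2r P0 h2; have := ler_wpM2r P0 (ler_wpM2l e6 h3).
  lra.
move: E; rewrite -[X in X <= _]mul1r ler_pM2r // => E.
rewrite -invfM -[X in X <= _]mul1r ler_pdivrMr ?mulr_gt0 //; lra.
Qed.
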